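(* A minimum consistent subset of $n$ collinear colored points can be computed in $O(n)$ time, provided that the points are given from left to right (i.e., sorted along the line).
   Context: Let $P$ be a set of $n$ points on a straight line, each assigned one color. A subset $S\subseteq P$ is a consistent subset of $P$ if for every point $p\in P\setminus S$, the closest point of $p$ in $S$ (in Euclidean distance) has the same color as $p$. A minimum consistent subset is a consistent subset of minimum cardinality. Running times are in the standard real-RAM model of computational geometry. *)

(* Defs.v *)
From HB Require Import structures.
From mathcomp Require Import all_boot all_order all_algebra.
From mathcomp Require Import reals.

Set Implicit Arguments.
Unset Strict Implicit.
Unset Printing Implicit Defensive.

Import Order.TTheory GRing.Theory Num.Theory.
Local Open Scope ring_scope.

(* The real RAM: unit-cost instructions on natural-number words and on exact
   reals.  Words only support addition and subtraction, and no instruction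
   converts a real into a word (no floor function). *)

Inductive word_op := WAdd | WSub.
Inductive real_op := RAdd | RSub | RMul | RDiv.

(* Registers are addressed by the constants occurring in the program, memory
   cells only through the content of a word register.  Below W, R are the word
   and real registers, MW, MR the word and real memories. *)
Inductive instr :=
| Halt
| Goto   (l : nat)
| WConst (d k : nat)                  (* W[d] := k                      *)
| WMove  (d a : nat)                  (* W[d] := W[a]                   *)
| WOp    (o : word_op) (d a b : nat)  (* W[d] := W[a] o W[b]            *)
| WLoad  (d a : nat)                  (* W[d] := MW[W[a]]               *)
| WStore (a b : nat)                  (* MW[W[a]] := W[b]               *)
| WIfEq  (a b l : nat)                (* if W[a] = W[b] then goto l     *)
| WIfLt  (a b l : nat)                (* if W[a] < W[b] then goto l     *)
| RConst (d k : nat)                  (* R[d] := k                      *)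
| RMove  (d a : nat)                  (* R[d] := R[a]                   *)
| ROp    (o : real_op) (d a b : nat)  (* R[d] := R[a] o R[b]            *)
| RLoad  (d a : nat)                  (* R[d] := MR[W[a]]               *)
| RStore (a b : nat)                  (* MR[W[a]] := R[b]               *)
| RIfEq  (a b l : nat)                (* if R[a] = R[b] then goto l     *)
| RIfLt  (a b l : nat).               (* if R[a] < R[b] then goto l     *)

Definition program := seq instr.

Record config (R : realType) := Config {
  pc   : nat;
  wreg : nat -> nat;
  rreg : nat -> R;
  wmem : nat -> nat;
  rmem : nat -> R }.

(* [WSub] is truncated subtraction; [RDiv] by zero yields zero. *)
Definition word_eval (o : word_op) (x y : nat) : nat :=
  match o with WAdd => (x + y)%N | WSub => (x - y)%N end.

Definition real_eval (R : realType) (o : real_op) (x y : R) : R :=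
  match o with
  | RAdd => x + y | RSub => x - y | RMul => x * y | RDiv => x / y
  end.

(* Labels are positions in the program; running past its end halts. *)
Definition fetch (R : realType) (P : program) (s : config R) : instr :=
  nth Halt P (pc s).

Definition halted (R : realType) (P : program) (s : config R) : bool :=
  if fetch P s is Halt then true else false.

Definition step (R : realType) (P : program) (s : config R) : config R :=
  let: Config l w r mw mr := s in
  match fetch P s with
  | Halt         => s
  | Goto l'      => Config l' w r mw mr
  | WConst d k   => Config l.+1 [eta w with d |-> k] r mw mr
  | WMove d a    => Config l.+1 [eta w with d |-> w a] r mw mr
  | WOp o d a b  => Config l.+1 [eta w with d |-> word_eval o (w a) (w b)] r mw mr
  | WLoad d a    => Config l.+1 [eta w with d |-> mw (w a)] r mw mr
  | WStore a b   => Config l.+1 w r [eta mw with w a |-> w b] mr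
  | WIfEq a b l' => Config (if w a == w b then l' else l.+1) w r mw mr
  | WIfLt a b l' => Config (if (w a < w b)%N then l' else l.+1) w r mw mr
  | RConst d k   => Config l.+1 w [eta r with d |-> k%:R] mw mr
  | RMove d a    => Config l.+1 w [eta r with d |-> r a] mw mr
  | ROp o d a b  => Config l.+1 w [eta r with d |-> real_eval o (r a) (r b)] mw mr
  | RLoad d a    => Config l.+1 w [eta r with d |-> mr (w a)] mw mr
  | RStore a b   => Config l.+1 w r mw [eta mr with w a |-> r b]
  | RIfEq a b l' => Config (if r a == r b then l' else l.+1) w r mw mr
  | RIfLt a b l' => Config (if r a < r b then l' else l.+1) w r mw mr
  end.

Definition run (R : realType) (P : program) (t : nat) (s : config R) : config R :=
  iter t (step P) s.

(* A colored point sequence is a tuple [p] of points of the plane together with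
   a tuple [col] of color labels; a set of points is a set of indices. *)

Definition edist (R : realType) (x y : R * R) : R :=
  Num.sqrt ((x.1 - y.1) ^+ 2 + (x.2 - y.2) ^+ 2).

(* The points are pairwise distinct, lie on the line through [a] with direction
   [d], and are listed in the order in which they occur along that line. *)
Definition sorted_on_line (R : realType) (n : nat) (p : n.-tuple (R * R)) : Prop :=
  exists (a d : R * R) (t : 'I_n -> R),
    [/\ d != (0, 0),
        forall i j : 'I_n, (i < j)%N -> t i < t j
      & forall i : 'I_n, tnth p i = (a.1 + t i * d.1, a.2 + t i * d.2)].

Definition closest_in (R : realType) (n : nat) (p : n.-tuple (R * R))
    (S : {set 'I_n}) (i j : 'I_n) : Prop :=
  j \in S /\
  forall k, k \in S -> edist (tnth p i) (tnth p j) <= edist (tnth p i) (tnth p k).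

(* When several points of [S] are closest to a point, one of them must have the
   right color. *)
Definition consistent (R : realType) (n : nat) (p : n.-tuple (R * R))
    (col : n.-tuple nat) (S : {set 'I_n}) : Prop :=
  forall i, i \notin S ->
    exists2 j, closest_in p S i j & tnth col j = tnth col i.

Definition minimum_consistent (R : realType) (n : nat) (p : n.-tuple (R * R))
    (col : n.-tuple nat) (S : {set 'I_n}) : Prop :=
  consistent p col S /\
  forall S' : {set 'I_n}, consistent p col S' -> (#|S| <= #|S'|)%N.

(* Input: W[0] = n, MW[i] is the color of the i-th point and (MR[2i], MR[2i+1])
   are its coordinates; everything else is 0. *)
Definition input (R : realType) (n : nat) (p : n.-tuple (R * R))
    (col : n.-tuple nat) : config R :=
  {| pc   := 0%N;
     wreg := fun k => if k == 0%N then n else 0%N;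
     rreg := fun=> 0;
     wmem := fun k => nth 0%N col k;
     rmem := fun k => let q := nth (0, 0) p k./2 in if odd k then q.2 else q.1 |}.

(* Output: W[0] = |S|, and MW[0], ..., MW[|S|-1] list the indices of the points
   of S, each once, in any order. *)
Definition outputs (R : realType) (n : nat) (s : config R) (S : {set 'I_n}) : bool :=
  perm_eq (mkseq (wmem s) (wreg s 0%N)) [seq nat_of_ord i | i <- enum S].

(* [P] computes a minimum consistent subset of every collinear colored point
   sequence of length [n] given in order along its line, in at most [T n] steps. *)
Definition solves_mcs_in_time (R : realType) (P : program) (T : nat -> nat) : Prop :=
  forall (n : nat) (p : n.-tuple (R * R)) (col : n.-tuple nat),
    sorted_on_line p ->
    exists (t : nat) (S : {set 'I_n}),
      [/\ (t <= T n)%N,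
          halted P (run P t (input p col)),
          outputs (run P t (input p col)) S
        & minimum_consistent p col S].

Definition bigO_linear (T : nat -> nat) : Prop :=
  exists c n0 : nat, forall n, (n0 <= n)%N -> (T n <= c * n)%N.

(* Main.v *)
Require Import Defs.
From HB Require Import structures.
From mathcomp Require Import all_boot all_order all_algebra.
From mathcomp Require Import reals.
From mathcomp Require Import zify ring lra.

(* A nonempty set S of points of the line is consistent if and only if every gap
   between two consecutive points of S splits into a left part with the color of
   its left end and a right part with the color of its right end, each point
   being at least as close to the end of its color, and the points outside of S
   before the first (after the last) point of S have the color of that point.
   So a minimum consistent subset is a shortest path for the relation [gap].
   Let D v be the least number of points of such a path that ends at v.  If v
   belongs to the block of equal colors that starts at g, the predecessor of v
   on a path lies in the same block, or it is a point u of the preceding block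
   with 2 x(g-1) <= x u + x v <= 2 x g.  On a block with minimum m, D takes
   values in {m, m+1, m+2}, and m+2 never matters for the next block: its
   first point can be reached from the last point of this one, where
   D <= m+1.  Hence D v is m+1 if the window for v contains a point with D = m,
   else m+2 if it contains one with D = m+1, else one more than the minimum of D
   over the earlier points of the block of v.  The window moves to the left when
   v moves to the right, and the leftmost point of each value right of its lower
   end is all that has to be remembered, which gives linear time.

   Coordinates along the line are obtained, up to an increasing affine map, as
   scalar products with the vector from the first to the last point. *)

Set Implicit Arguments.
Unset Strict Implicit.
Unset Printing Implicit Defensive.

Import Order.TTheory GRing.Theory Num.Theory.

(** * Shortest chains of points *)

Section LinePoints.

Variables (R : realType) (n : nat) (x : nat -> R) (col : nat -> nat).
Hypothesis x_mono : forall i j, i < j -> j < n -> (x i < x j)%R.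

(** The inequalities place [x k] relative to the midpoint of [x u] and [x v] without a division. A
    point at the midpoint may have either color, in accordance with the treatment of ties in
    [consistent]. *)
Definition gap (u v : nat) : Prop :=
  u < v /\ forall k, u < k < v ->
    (col k = col u /\ (x k + x k <= x u + x v)%R) \/
    (col k = col v /\ (x u + x v <= x k + x k)%R).

Definition leading (i : nat) : Prop := forall k, k < i -> col k = col i.

Definition trailing (i : nat) : Prop := forall k, i < k < n -> col k = col i.

Lemma x_le i j : i <= j -> j < n -> (x i <= x j)%R.
Proof.
rewrite leq_eqVlt => /orP[/eqP -> //|ij jn]; exact/ltW/x_mono.
Qed.

(* [P i = n] marks the start of a path. *)
Record shortest (v : nat) (D P : nat -> nat) : Prop := Shortest {
  shortest_pred : forall i, i < v ->
    (leading i /\ D i = 1 /\ P i = n) \/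
    (P i < i /\ gap (P i) i /\ D i = (D (P i)).+1);
  shortest_leading : forall i, i < v -> leading i -> D i = 1;
  shortest_gap : forall u i, i < v -> gap u i -> D i <= (D u).+1 }.

Lemma shortest_ext v D P D' P' :
  (forall i, i < v -> D' i = D i) -> (forall i, i < v -> P' i = P i) ->
  shortest v D P -> shortest v D' P'.
Proof.
move=> eD eP [h1 h2 h3]; split.
- move=> i iv; rewrite eD // eP //.
  case: (h1 i iv) => [|[a [b c]]]; first by left.
  by right; rewrite (eD (P i)) //; apply: ltn_trans iv.
- by move=> i iv /(h2 i iv); rewrite eD.
- move=> u i iv g; rewrite eD // eD; first exact: h3.
  by case: g => ui _; apply: ltn_trans iv.
Qed.

(* The points are scanned from left to right.  The next point to be treated is
   [v]; its block starts at [g] and the preceding block is [f, g).  Among the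
   points of the preceding block that lie in [lo, g), [a] and [b] are the
   leftmost ones with [D] equal to [m] and [m + 1] ([g] if there is none), and
   [q] is a point of [g, v) with minimal [D].
   At the start of a block [d] exceeds every value that its first point can get. *)
Record scan (v g f lo a b q d m : nat) (D P : nat -> nat) : Prop := Scan {
  scan_short : shortest v D P;
  scan_vn : v <= n;
  scan_gv : g <= v;
  scan_gn : 0 < n -> g < n;
  scan_block : forall k, g <= k < v -> col k = col g;
  scan_fg : 0 < g -> f < g;
  scan_lo : f <= lo <= g;
  scan_prev : forall k, f <= k < g -> col k = col f;
  scan_colg : 0 < g -> col f <> col g;
  scan_colf : 0 < f -> col f.-1 <> col f;
  scan_m : forall u, f <= u < g -> m <= D u;
  scan_m1 : 0 < g -> D g.-1 <= m.+1;
  scan_a : lo <= a <= g;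
  scan_Da : a < g -> D a = m;
  scan_aN : forall u, lo <= u < a -> D u <> m;
  scan_b : lo <= b <= g;
  scan_Db : b < g -> D b = m.+1;
  scan_bN : forall u, lo <= u < b -> D u <> m.+1;
  scan_window : forall u, v < n -> lo <= u < g -> (x g.-1 + x g.-1 <= x u + x v)%R;
  scan_q : g < v -> g <= q < v /\ D q = d;
  scan_d : forall i, g <= i < v -> d <= D i;
  scan_dm : 0 < g -> forall i, g <= i < v -> m < D i;
  scan_dv : g < v -> 0 < g -> d <= m.+2;
  scan_d0 : v = g -> d = if g == 0 then 2 else m.+3;
  scan_q0 : n = 0 -> q = n }.

(** Storing the entries of [v] leaves [D] and [P] unchanged below [v], and the invariant reads them
    nowhere else. *)
Lemma scan_ext v g f lo a b q d m D P D' P' :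
  (forall i, i < v -> D' i = D i) -> (forall i, i < v -> P' i = P i) ->
  scan v g f lo a b q d m D P -> scan v g f lo a b q d m D' P'.
Proof.
move=> eD eP h; have gv := scan_gv h; have flog := scan_lo h.
have loag := scan_a h; have lobg := scan_b h; split; try by case: h.
- exact: shortest_ext (scan_short h).
- move=> u hu; rewrite eD; [exact: scan_m h _ hu|lia].
- move=> hu; rewrite eD; [exact: scan_m1 h hu|lia].
- move=> hu; rewrite eD; [exact: scan_Da h hu|lia].
- move=> u hu; rewrite eD; [exact: scan_aN h _ hu|lia].
- move=> hu; rewrite eD; [exact: scan_Db h hu|lia].
- move=> u hu; rewrite eD; [exact: scan_bN h _ hu|lia].
- move=> gv0; have [gq <-] := scan_q h gv0; rewrite eD //; lia.
- move=> i hi; rewrite eD; [exact: scan_d h _ hi|lia].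
- move=> g0 i hi; rewrite eD; [exact: scan_dm h g0 _ hi|lia].
Qed.

(** The completed block becomes the preceding one: its minimum [d] is the new [m], the window starts
    empty, and [d.+3] is the sentinel [m.+3] for the new [m]. *)
Lemma scan_new_block v g f lo a b q d m D P :
  scan v g f lo a b q d m D P -> v < n -> col v <> col g ->
  scan v v g v v v q d.+3 d D P.
Proof.
move=> h vn cvg.
have gv : g < v.
  by rewrite ltn_neqAle (scan_gv h) andbT; apply/eqP => e; rewrite e in cvg.
have [gq Dq] := scan_q h gv.
split=> //; try by move=> *; lia.
- exact: scan_short h.
- exact: scan_block h.
- move=> g0; have -> : col g.-1 = col f.
    by apply: (scan_prev h); have := scan_fg h g0; lia.
  exact: scan_colg h g0.
- exact: scan_d h.
(* One step inside the block leads from the minimal point [q] to the last point [v.-1]. *)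
- move=> _; have [e|e] := eqVneq q v.-1; first by rewrite -e Dq.
  rewrite -Dq; apply: (shortest_gap (scan_short h)); first lia.
  split; first lia.
  move=> k hk; have ck : col k = col q by rewrite !(scan_block h) //; lia.
  have cv : col v.-1 = col q by rewrite !(scan_block h) //; lia.
  rewrite ck cv.
  by case: (lerP (x k + x k) (x q + x v.-1)) => [?|/ltW ?]; [left|right].
- by move=> e; case: eqP => //; lia.
Qed.

(** The window only grows to the left, so a point that enters it is the new leftmost one of its
    value. *)
Lemma scan_move v g f lo a b q d m D P :
  scan v g f lo a b q d m D P -> v < n -> f < lo ->
  (x g.-1 + x g.-1 <= x lo.-1 + x v)%R ->
  scan v g f lo.-1 (if D lo.-1 == m then lo.-1 else a)
    (if D lo.-1 == m.+1 then lo.-1 else b) q d m D P.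
Proof.
move=> h vn flo hw.
have flog := scan_lo h; have loag := scan_a h; have lobg := scan_b h.
split=> //; try by case: h.
- lia.
- case: ifP; lia.
- by case: eqP => // _; exact: scan_Da h.
- move=> u; case: eqP => [_|ne]; first lia.
  by have [-> //|?] := eqVneq u lo.-1 => hu; apply: (scan_aN h); lia.
- case: ifP; lia.
- by case: eqP => // _; exact: scan_Db h.
- move=> u; case: eqP => [_|ne]; first lia.
  by have [-> //|?] := eqVneq u lo.-1 => hu; apply: (scan_bN h); lia.
- move=> u _ hu; have [-> //|?] := eqVneq u lo.-1; apply: (scan_window h) => //; lia.
Qed.

(* The value and the predecessor that the scan assigns to [v], given that
   [lo] cannot be moved further to the left. *)
Variant assigned (v g a b q d m : nat) : nat -> nat -> Prop :=
| AssignFirst of g = 0 : assigned v g a b q d m 1 n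
| AssignLow of 0 < g & a < g & (x a + x v <= x g + x g)%R :
    assigned v g a b q d m m.+1 a
| AssignHigh of 0 < g & (a < g -> (x g + x g < x a + x v)%R) & b < g &
    (x b + x v <= x g + x g)%R : assigned v g a b q d m m.+2 b
| AssignBlock of 0 < g & (a < g -> (x g + x g < x a + x v)%R) &
    (b < g -> (x g + x g < x b + x v)%R) : assigned v g a b q d m d.+1 q.

Lemma gap_block g v u :
  v < n -> (forall k, g <= k <= v -> col k = col g) -> g <= u < v -> gap u v.
Proof.
move=> vn hc hu; split; first lia.
move=> k hk; have ck : col k = col g by apply: hc; lia.
have cu : col u = col g by apply: hc; lia.
have cv : col v = col g by apply: hc; lia.
rewrite ck cu cv.
by case: (lerP (x k + x k) (x u + x v)) => [?|/ltW ?]; [left|right].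
Qed.

Lemma gap_window f g v u :
  v < n -> (forall k, f <= k < g -> col k = col f) ->
  (forall k, g <= k <= v -> col k = col g) -> f <= u < g -> g <= v ->
  (x g.-1 + x g.-1 <= x u + x v)%R -> (x u + x v <= x g + x g)%R -> gap u v.
Proof.
move=> vn hf hg hu gv w1 w2; split; first lia.
move=> k hk; case: (ltnP k g) => kg.
- left; split; first by rewrite !hf //; lia.
  have : (x k <= x g.-1)%R by apply: x_le; lia.
  lra.
- right; split; first by rewrite !hg //; lia.
  have : (x g <= x k)%R by apply: x_le; lia.
  lra.
Qed.

(* If [u] were before [f], then the last point of [f, g) would be closer to [u]
   than to [v], hence so would be the last point before [f], although these
   two points have different colors. *)
Lemma gap_inv f g v u :
  v < n -> f < g -> g <= v -> (forall k, f <= k < g -> col k = col f) ->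
  (forall k, g <= k <= v -> col k = col g) -> col f <> col g ->
  (0 < f -> col f.-1 <> col f) -> gap u v ->
  g <= u \/ [/\ f <= u < g, (x g.-1 + x g.-1 <= x u + x v)%R
              & (x u + x v <= x g + x g)%R].
Proof.
move=> vn fg gv hf hg cfg cf [uv hgap].
case: (leqP g u) => gu; [by left|right].
have cg1 : col g.-1 = col f by apply: hf; lia.
have cv : col v = col g by apply: hg; lia.
have [w1 cu] : (x g.-1 + x g.-1 <= x u + x v)%R /\ col u = col f.
  have [e|ne] := eqVneq u g.-1.
    rewrite -e; split; last by rewrite e.
    have : (x u < x v)%R by apply: x_mono.
    lra.
  have [[e w]|[e _]] : _ := hgap g.-1 ltac:(lia); last by case: cfg; rewrite -cg1 e.
  by split=> //; rewrite -e.
have fu : f <= u.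
  case: (leqP f u) => // uf; exfalso.
  have f0 : 0 < f by lia.
  have [e|ne] := eqVneq u f.-1; first by apply: (cf f0); rewrite -e.
  have [[e _]|[_ w]] : _ := hgap f.-1 ltac:(lia); first by apply: (cf f0); rewrite e.
  have : (x f.-1 < x g.-1)%R by apply: x_mono; lia.
  lra.
split=> //; first lia.
have [e|ne] := eqVneq g v.
  rewrite -e; have : (x u < x g)%R by apply: x_mono => //; lia.
  lra.
have [[e _]|[_ //]] : _ := hgap g ltac:(lia).
by case: cfg; rewrite e.
Qed.

(** The assigned value is attained ([dvP]) and no gap into [v] gives less ([low]). By the hypothesis
    on [lo], points of the preceding block left of the window are too far away to have a gap to
    [v]. *)
Lemma scan_assign v g f lo a b q d m D P dv pv :
  scan v g f lo a b q d m D P -> v < n -> col v = col g ->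
  (f < lo -> (x lo.-1 + x v < x g.-1 + x g.-1)%R) ->
  assigned v g a b q d m dv pv -> D v = dv -> P v = pv ->
  scan v.+1 g f lo a b (if dv < d then v else q) (if dv < d then dv else d) m D P.
Proof.
move=> h vn cvg hlo hass Dv Pv.
have gev := scan_gv h; have flog := scan_lo h; have loag := scan_a h.
have lobg := scan_b h; have fg := scan_fg h.
have hg k : g <= k <= v -> col k = col g.
  by have [->//|?] := eqVneq k v => ?; apply: (scan_block h); lia.
have notlead : 0 < g -> ~ leading v.
  move=> g0 hl; apply: ((scan_colg h) g0); rewrite -cvg; apply: hl.
  by have := fg g0; lia.
have fst0 i : g = 0 -> i <= v -> leading i.
  by move=> g0 iv k ki; rewrite !hg //; lia.
have below u : u < lo -> f <= u -> (x u + x v < x g.-1 + x g.-1)%R.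
  move=> ulo fu; have : (x u <= x lo.-1)%R by apply: x_le; lia.
  have := hlo ltac:(lia); lra.
have winP u : 0 < g -> gap u v -> g <= u \/
    [/\ f <= u < g, (x g.-1 + x g.-1 <= x u + x v)%R
      & (x u + x v <= x g + x g)%R].
  move=> g0; have [cfg cf] := (scan_colg h g0, scan_colf h).
  exact: (gap_inv vn (fg g0) gev (scan_prev h) hg cfg cf).
have start : 0 < g -> v = g -> (a < g -> (x g + x g < x a + x v)%R) ->
    (b < g -> (x g + x g < x b + x v)%R) -> False.
  move=> g0 vg na nb; 
  have w : (x g.-1 + x g.-1 <= x g.-1 + x v)%R.
    rewrite lerD2l; apply: x_le => //; lia.
  have w' : (x g.-1 + x v <= x g + x g)%R.
    rewrite vg lerD2r; apply: x_le; lia.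
  have glo : lo <= g.-1.
    case: (leqP lo g.-1) => // l; have := below g.-1 l ltac:(lia).
    by rewrite ltNge w.
  have Dg := scan_m1 h g0; have mg := (scan_m h) g.-1 ltac:(lia).
  have [e|ne] := eqVneq (D g.-1) m.
    case: (leqP a g.-1) => ag; last by case: ((scan_aN h) g.-1) => //; lia.
    have := na ltac:(lia); have : (x a <= x g.-1)%R by apply: x_le; lia.
    lra.
  have e : D g.-1 = m.+1 by lia.
  case: (leqP b g.-1) => bg; last by case: ((scan_bN h) g.-1) => //; lia.
  have := nb ltac:(lia); have : (x b <= x g.-1)%R by apply: x_le; lia.
  lra.
have dvP : [/\ g = 0, dv = 1 & pv = n] \/
    [/\ 0 < g, gap pv v, dv = (D pv).+1, m < dv & g < v -> dv <= d.+1].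
  have gd (g0 : 0 < g) : g < v -> m < d.
    by move=> gv; have [qv <-] := scan_q h gv; apply: (scan_dm h).
  case: hass => [|g0 ag w|g0 na bg w|g0 na nb]; [by left|right|right|right].
  - split=> //; last by move=> ?; have := gd g0; lia.
      apply: (gap_window vn (scan_prev h) hg) => //; try lia.
      by apply: (scan_window h) => //; lia.
    by rewrite (scan_Da h).
  - split=> //; last by move=> ?; have := gd g0; lia.
      apply: (gap_window vn (scan_prev h) hg) => //; try lia.
      by apply: (scan_window h) => //; lia.
    by rewrite (scan_Db h).
  - have gv : g < v by case: (ltnP g v) => // vg; case: (start g0) => //; lia.
    have [qv Dq] := scan_q h gv; have := gd g0 gv => md.
    split=> //; [exact: (gap_block vn hg) | by rewrite Dq | lia].
have dvm : 0 < g -> v = g -> dv <= m.+2.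
  by move=> g0 vg; case: hass => [|_ _ _|_ _ _ _|_ na nb]; lia.
have low u : gap u v -> dv <= (D u).+1.
  move=> guv; have uv : u < v by case: guv.
  case: dvP => [[_ -> _] //|[g0 _ _ mdv dvd]].
  case: (winP u g0 guv) => [gu|[fu w1 w2]].
    have := (scan_d h) u ltac:(lia); have := dvd ltac:(lia); lia.
  have lou : lo <= u.
    by case: (leqP lo u) => // l; have := below u l ltac:(lia); lra.
  have mu := (scan_m h) u fu.
  have [e|ne] := eqVneq (D u) m.
    have au : a <= u by case: (leqP a u) => // l; case: ((scan_aN h) u) => //; lia.
    have wa : (x a + x v <= x g + x g)%R.
      have : (x a <= x u)%R by apply: x_le; lia.
      lra.
    case: hass => [|_ _ _|_ na _ _|_ na _]; try lia.
      by have := na ltac:(lia); lra.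
    by have := na ltac:(lia); lra.
  have [e'|ne'] := eqVneq (D u) m.+1.
    have bu : b <= u by case: (leqP b u) => // l; case: ((scan_bN h) u) => //; lia.
    have wb : (x b + x v <= x g + x g)%R.
      have : (x b <= x u)%R by apply: x_le; lia.
      lra.
    case: hass => [|_ _ _|_ _ _ _|_ _ nb]; try lia.
    by have := nb ltac:(lia); lra.
  (* Here [D u] is at least [m.+2], whereas [dv] is at most [m.+2] at the start of the block and at
     most [d.+1], hence [m.+3], later on. *)
  have [vg|gv] : v = g \/ g < v by lia.
    by have := dvm g0 vg; lia.
  have := scan_dv h gv g0; have := dvd gv; lia.
(* The first point of a block beats the sentinel, so it becomes [q]. *)
have dvd0 : v = g -> dv < d.
  move=> vg; rewrite (scan_d0 h) //; case: eqP => [g0|g0].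
    by case: dvP => [[_ -> _] //|[]]; lia.
  have := dvm ltac:(lia) vg; lia.
split=> //; try by case: h.
- case: (scan_short h) => h1 h2 h3; split.
  + move=> i; rewrite ltnS leq_eqVlt => /orP[/eqP ->|iv]; last exact: h1.
    rewrite Dv Pv; case: dvP => [[g0 -> ->]|[g0 hgap -> _ _]].
      by left; split=> //; apply: fst0.
    by right; split=> //; case: hgap.
  + move=> i; rewrite ltnS leq_eqVlt => /orP[/eqP ->|iv]; last exact: h2.
    rewrite Dv => hl; case: dvP => [[_ -> _] //|[g0 _ _ _ _]].
    by case: (notlead g0).
  + move=> u i; rewrite ltnS leq_eqVlt => /orP[/eqP ->|iv]; last exact: h3.
    by rewrite Dv; apply: low.
- lia.
- move=> u v1n hu; apply: le_trans ((scan_window h) u vn hu) _.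
  by rewrite lerD2l; apply/ltW/x_mono.
- move=> _; case: ltnP => dvd; first by rewrite Dv; split=> //; lia.
  have gv : g < v by have := dvd0; lia.
  by have [? ?] := scan_q h gv; split=> //; lia.
- move=> i hi; case: ltnP => dvd; have [->|ne] := eqVneq i v; rewrite ?Dv //.
  + by have := (scan_d h) i ltac:(lia); lia.
  + by apply: (scan_d h); lia.
- move=> g0 i hi; have [->|ne] := eqVneq i v; last by apply: (scan_dm h) => //; lia.
  by rewrite Dv; case: dvP => [[]|[]]; lia.
- move=> _ g0; have [vg|gv] : v = g \/ g < v by lia.
    by have := dvm g0 vg; have := dvd0 vg; case: ltnP; lia.
  by have := scan_dv h gv g0; case: ltnP; lia.
- lia.
- by move=> n0; lia.
Qed.

(** A trailing point lies in the last block, because the colors of [g.-1] and [g] differ; [q] is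
    minimal there. *)
Lemma scan_end g f lo a b q d m D P :
  scan n g f lo a b q d m D P -> 0 < n ->
  [/\ q < n, trailing q & forall e, e < n -> trailing e -> D q <= D e].
Proof.
move=> h n0; have gn := scan_gn h n0; have [qn Dq] := scan_q h gn.
split; first by case/andP: qn.
- by move=> k hk; rewrite !(scan_block h) //; lia.
- move=> e en te; rewrite Dq; apply: (scan_d h); rewrite en andbT leqNgt.
  apply/negP => eg; have g0 : 0 < g by lia.
  apply: (scan_colg h g0); have <- : col g.-1 = col f.
    by apply: (scan_prev h); have := scan_fg h g0; lia.
  rewrite (te g) ?eg //; have [->//|ne] := eqVneq e g.-1.
  by apply: te; lia.
Qed.

End LinePoints.

(** * Following predecessors back to the start of a path *)

Section Chains.

Variables (R : realType) (n : nat) (x : nat -> R) (col : nat -> nat).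
Variables (D P : nat -> nat).
Hypothesis DP : shortest n x col n D P.

Lemma shortest_gt0 i : i < n -> 0 < D i.
Proof. by move=> /(shortest_pred DP)[[_ []]|[_ [_]]] ->. Qed.

(** This bounds the size of the output by [n], both for the running time and to keep the output from
    overwriting the predecessors. *)
Lemma shortest_le i : i < n -> D i <= i.+1.
Proof.
elim/ltn_ind: i => i IH ilt.
case: (shortest_pred DP ilt) => [[_ [-> _]] //|[Pi [_ ->]]].
by have := IH (P i) Pi ltac:(lia); lia.
Qed.

(** Each predecessor lowers [D] by exactly one, so the walk cannot reach the marker [n] before [D i]
    steps. *)
Lemma iter_pred i j : i < n -> j < D i -> iter j P i < n /\ D (iter j P i) + j = D i.
Proof.
move=> ilt; elim: j => [|j IH] jD /=; first by rewrite addn0.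
have [klt Dk] := IH ltac:(lia).
case: (shortest_pred DP klt) => [[_ [D1 _]]|[Pk [_ Dk']]]; first lia.
by split; lia.
Qed.

Lemma iter_pred_step i j : i < n -> j.+1 < D i ->
  let k := iter j P i in P k < k /\ gap x col (P k) k.
Proof.
move=> ilt jD /=; have [klt Dk] := iter_pred ilt (ltnW jD).
by case: (shortest_pred DP klt) => [[_ [D1 _]]|[Pk [gk _]]]; [lia|split].
Qed.

(** After [(D i).-1] steps the value is 1, which only the start of a path can have; one more step
    gives the marker. *)
Lemma iter_pred_last i : i < n ->
  leading col (iter (D i).-1 P i) /\ iter (D i) P i = n.
Proof.
move=> ilt; have D0 := shortest_gt0 ilt.
have [klt Dk] := iter_pred ilt (ltac:(lia) : (D i).-1 < D i).
rewrite -[in iter (D i)](prednK D0) iterS.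
case: (shortest_pred DP klt) => [[lk [_ ->]]|[Pk [_ Dk']]]; first by split.
have := shortest_gt0 (ltn_trans Pk klt); lia.
Qed.

Lemma iter_pred_ltn i j k : i < n -> j < k < D i -> iter k P i < iter j P i.
Proof.
move=> ilt; elim: k => [|k IH] hk; first lia.
have [lt _] := iter_pred_step ilt (ltac:(lia) : k.+1 < D i); rewrite iterS.
have [->//|ne] := eqVneq j k.
by apply: ltn_trans lt _; apply: IH; lia.
Qed.

End Chains.

(** * Consistent subsets as paths for the relation [gap] *)

Section Consistent.

Variables (R : realType) (n : nat) (x : nat -> R).
Variables (p : n.-tuple (R * R)) (c : n.-tuple nat).
Hypothesis x_mono : forall i j, i < j -> j < n -> (x i < x j)%R.
Hypothesis edist_le : forall i j k : 'I_n,
  (edist (tnth p i) (tnth p j) <= edist (tnth p i) (tnth p k))%R =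
  (`|x i - x j| <= `|x i - x k|)%R.

Let col k := nth 0 c k.

Lemma dist_left (i j : 'I_n) : j <= i -> (`|x i - x j| = x i - x j)%R.
Proof. by move=> ji; rewrite ger0_norm // subr_ge0; apply: (x_le x_mono). Qed.

Lemma dist_right (i j : 'I_n) : i <= j -> (`|x i - x j| = x j - x i)%R.
Proof. by move=> ij; rewrite distrC dist_left. Qed.

(** This is the path condition on a set: only its extreme points and its pairs of consecutive points
    are constrained. *)
Record linked (S : {set 'I_n}) : Prop := Linked {
  linked_nonempty : exists i, i \in S;
  linked_leading : forall v, v \in S -> (forall k, k \in S -> v <= k) ->
    leading col v;
  linked_gap : forall u v, u \in S -> v \in S -> u < v ->
    (forall k, k \in S -> k <= u \/ v <= k) -> gap x col u v;
  linked_trailing : forall u, u \in S -> (forall k, k \in S -> k <= u) ->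
    trailing n col u }.

(** A closest point of [S] is always a neighbor of the given point in [S], by strict monotonicity of
    [x]. Positivity of [n] excludes the empty set, which is consistent when there are no points. *)
Lemma consistent_linked (S : {set 'I_n}) : 0 < n -> consistent p c S -> linked S.
Proof.
move=> n0 hS.
have near (k : 'I_n) : k \notin S -> exists j : 'I_n, [/\ j \in S, col j = col k &
    forall l : 'I_n, l \in S -> (`|x k - x j| <= `|x k - x l|)%R].
  move=> kS; have [j [jS jmin] jc] := hS k kS; exists j; split=> //.
    by rewrite /col -!tnth_nth.
  by move=> l lS; rewrite -edist_le; apply: jmin.
split.
- have [i0S|/near[j [jS _ _]]] := boolP (Ordinal n0 \in S).
    by exists (Ordinal n0).
  by exists j.
- move=> v vS vmin k kv; have kn := ltn_trans kv (ltn_ord v).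
  have kS : Ordinal kn \notin S by apply/negP => /vmin /=; lia.
  have [j [jS jc jmin]] := near _ kS; rewrite /= in jc.
  rewrite -jc; have vj := vmin _ jS.
  have := jmin _ vS; rewrite !dist_right //=; try lia.
  rewrite lerD2r; case: (ltnP v j) => [lt|le _].
    by rewrite leNgt x_mono.
  by congr col; lia.
- move=> u v uS vS uv huv; split=> // k /andP[uk kv].
  have kn := ltn_trans kv (ltn_ord v).
  have kS : Ordinal kn \notin S by apply/negP => /huv /=; lia.
  have [j [jS jc jmin]] := near _ kS; rewrite /= in jc; rewrite -jc.
  have ju := jmin _ uS; have jv := jmin _ vS.
  case: (huv _ jS) => [le|le].
  + left; have e : j = u.
      move: ju; rewrite !dist_left //=; try lia.
      rewrite lerD2l lerN2; case: (ltnP j u) => [lt|? _].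
        by rewrite leNgt x_mono.
      by apply: val_inj; apply/eqP; rewrite eqn_leq le.
    rewrite -e; split=> //; move: jv; rewrite dist_left ?dist_right //=; try lia.
    lra.
  + right; have e : j = v.
      move: jv; rewrite !dist_right //=; try lia.
      rewrite lerD2r; case: (ltnP v j) => [lt|? _].
        by rewrite leNgt x_mono.
      by apply: val_inj; apply/eqP; rewrite eqn_leq le andbT.
    rewrite -e; split=> //; move: ju; rewrite dist_right ?dist_left //=; try lia.
    lra.
- move=> u uS umax k /andP[uk kn].
  have kS : Ordinal kn \notin S by apply/negP => /umax /=; lia.
  have [j [jS jc jmin]] := near _ kS; rewrite /= in jc.
  rewrite -jc; have uj := umax _ jS.
  have := jmin _ uS; rewrite !dist_left //=; try lia.
  rewrite lerD2l lerN2; case: (ltnP j u) => [lt|le _].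
    by rewrite leNgt x_mono.
  by congr col; lia.
Qed.

(** For a point outside [S], take its neighbors in [S] on both sides. If one is missing, the other
    is closest and has the right color; otherwise the gap between them tells which one to choose. *)
Lemma linked_consistent (S : {set 'I_n}) : linked S -> consistent p c S.
Proof.
move=> [[i0 i0S] hlead hgap htrail] i iS.
have closest (j : 'I_n) : j \in S -> col j = col i ->
    (forall k : 'I_n, k \in S -> (`|x i - x j| <= `|x i - x k|)%R) ->
    exists2 j, closest_in p S i j & tnth c j = tnth c i.
  move=> jS jc jmin; exists j; last by rewrite !(tnth_nth 0).
  by split=> // k kS; rewrite edist_le jmin.
have neq (k : 'I_n) : k \in S -> k < i \/ i < k.
  move=> kS; have : k != i :> nat by apply: contraNneq iS => /val_inj <-.
  lia.
have ltx := x_le x_mono.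
have [hl|nl] := boolP [exists k : 'I_n, (k \in S) && (k < i)]; last first.
  have gi (k : 'I_n) : k \in S -> i < k.
    move=> kS; case: (neq _ kS) => // ki; case/negP: nl.
    by apply/existsP; exists k; rewrite kS.
  case: (@arg_minnP _ i0 (mem S) (@nat_of_ord n) i0S) => v vS vmin.
  apply: (closest v) => // [|k kS].
    by rewrite (hlead v vS vmin) // gi.
  by rewrite !dist_right ?lerD2r ?ltx ?vmin // ltnW ?gi.
have {hl} [u /andP[uS ui] umax] : exists2 u : 'I_n, (u \in S) && (u < i) &
    forall k : 'I_n, k \in S -> k < i -> k <= u.
  case/existsP: hl => k0 hk0.
  case: (@arg_maxnP _ k0 [pred k : 'I_n | (k \in S) && (k < i)] (@nat_of_ord n) hk0).
  by move=> u hu umax; exists u => // k kS ki; apply: umax; rewrite /= kS.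
have [hr|nr] := boolP [exists k : 'I_n, (k \in S) && (i < k)]; last first.
  have li (k : 'I_n) : k \in S -> k < i.
    move=> kS; case: (neq _ kS) => // ki; case/negP: nr.
    by apply/existsP; exists k; rewrite kS.
  have lu (k : 'I_n) : k \in S -> k <= u by move=> kS; apply/umax/li.
  apply: (closest u) => // [|k kS].
    by rewrite (htrail u uS lu) // ui ltn_ord.
  by rewrite !dist_left ?lerD2l ?lerN2 ?ltx ?lu // ltnW ?li.
have {hr} [v /andP[vS iv] vmin] : exists2 v : 'I_n, (v \in S) && (i < v) &
    forall k : 'I_n, k \in S -> i < k -> v <= k.
  case/existsP: hr => k0 hk0.
  case: (@arg_minnP _ k0 [pred k : 'I_n | (k \in S) && (i < k)] (@nat_of_ord n) hk0).
  by move=> v hv vmin; exists v => // k kS ki; apply: vmin; rewrite /= kS.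
have huv (k : 'I_n) : k \in S -> k <= u \/ v <= k.
  by move=> kS; case: (neq _ kS) => ?; [left; apply: umax|right; apply: vmin].
have [_ g] := hgap u v uS vS (ltn_trans ui iv) huv.
case: (g i) => [|[ci di]|[ci di]]; first by rewrite ui.
- apply: (closest u) => // k kS; rewrite dist_left 1?ltnW //.
  case: (huv k kS) => hk.
    have := ltx k u hk (ltn_ord u); rewrite dist_left; [lra|lia].
  have := ltx v k hk (ltn_ord k); rewrite dist_right; [lra|lia].
- apply: (closest v) => // k kS; rewrite dist_right 1?ltnW //.
  case: (huv k kS) => hk.
    have := ltx k u hk (ltn_ord u); rewrite dist_left; [lra|lia].
  have := ltx v k hk (ltn_ord k); rewrite dist_right; [lra|lia].
Qed.

Variables (D P : nat -> nat).
Hypothesis DP : shortest n x col n D P.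

(** Induction along [S]: passing from the preceding element of [S] to [e] raises [D] by at most one
    and the cardinality by at least one. *)
Lemma linked_card (S : {set 'I_n}) : linked S ->
  forall e, e \in S -> D e <= #|[set i in S | i <= e]|.
Proof.
move=> hS e; move: {2}(nat_of_ord e) (erefl (nat_of_ord e)) => k.
elim/ltn_ind: k e => k IH e ek eS.
have [hl|nl] := boolP [exists k : 'I_n, (k \in S) && (k < e)]; last first.
  have -> : D e = 1.
    apply: (shortest_leading DP) => //; apply: (linked_leading hS) => // l lS.
    by rewrite leqNgt; apply: contra nl => le; apply/existsP; exists l; rewrite lS.
  by apply/card_gt0P; exists e; rewrite inE eS /=.
case/existsP: hl => k0 hk0.
case: (@arg_maxnP _ k0 [pred k : 'I_n | (k \in S) && (k < e)] (@nat_of_ord n) hk0).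
move=> u /andP[uS ue] umax.
have ge : gap x col u e.
  apply: (linked_gap hS) => // l lS; case: (ltnP l e) => le; [left|by right].
  by apply: umax; rewrite /= lS.
have := IH u ltac:(lia) u erefl uS; have := shortest_gap DP (ltn_ord e) ge.
suff : #|[set i in S | i <= u]| < #|[set i in S | i <= e]| by lia.
apply: proper_card; apply/properP; split.
  by apply/subsetP => i; rewrite !inE => /andP[-> /=]; lia.
by exists e; rewrite !inE eS /=; lia.
Qed.

(** The trajectory of length [D q] stops just before the marker [n]. *)
Definition chain_set (q : nat) : {set 'I_n} :=
  [set i : 'I_n | val i \in traject P q (D q)].

Lemma chain_setP q (i : 'I_n) :
  reflect (exists2 j, j < D q & i = iter j P q :> nat) (i \in chain_set q).
Proof. by rewrite inE; apply: (iffP trajectP). Qed.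

Lemma traject_uniq q : q < n -> uniq (traject P q (D q)).
Proof.
move=> qn; apply/(uniqP q) => i j; rewrite !inE size_traject => hi hj.
rewrite !nth_traject //; case: (ltngtP i j) => // lt e.
  by have := iter_pred_ltn DP qn (ltac:(lia) : i < j < D q); rewrite e ltnn.
by have := iter_pred_ltn DP qn (ltac:(lia) : j < i < D q); rewrite e ltnn.
Qed.

Lemma chain_set_enum q : q < n ->
  perm_eq (traject P q (D q)) [seq nat_of_ord i | i <- enum (chain_set q)].
Proof.
move=> qn; apply: uniq_perm; first exact: traject_uniq.
  by rewrite map_inj_uniq ?enum_uniq //; apply: val_inj.
move=> k; apply/idP/mapP => [kt|[i]]; last by rewrite mem_enum inE => h ->.
have kn : k < n by case/trajectP: kt => j jD ->; case: (iter_pred DP qn jD).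
by exists (Ordinal kn) => //; rewrite mem_enum inE.
Qed.

Lemma card_chain_set q : q < n -> #|chain_set q| = D q.
Proof.
move=> qn; have /perm_size := chain_set_enum qn.
by rewrite size_traject size_map -cardE => <-.
Qed.

Lemma chain_set_linked q : q < n -> trailing n col q -> linked (chain_set q).
Proof.
move=> qn qt.
have mem j : j < D q -> exists2 i : 'I_n, i \in chain_set q & i = iter j P q :> nat.
  move=> jD; have [kn _] := iter_pred DP qn jD.
  by exists (Ordinal kn) => //; apply/chain_setP; exists j.
have D0 := shortest_gt0 DP qn.
have anti j k : j < D q -> k < D q -> iter k P q < iter j P q -> j < k.
  move=> jD kD lt; case: (ltngtP j k) lt => // [kj|-> ]; last by rewrite ltnn.
  by have := iter_pred_ltn DP qn (ltac:(lia) : k < j < D q); lia.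
split.
- by have [i iS _] := mem 0 D0; exists i.
- move=> v /chain_setP[j jD ej] vmin.
  have [i iS ei] := mem (D q).-1 ltac:(lia).
  have [e|ne] := eqVneq (D q).-1 j.
    by rewrite ej -e; case: (iter_pred_last DP qn).
  have := iter_pred_ltn DP qn (ltac:(lia) : j < (D q).-1 < D q).
  by have := vmin i iS; lia.
- move=> u v /chain_setP[k kD eu] /chain_setP[j jD ev] uv huv.
  (* Iterates decrease, so consecutive elements have consecutive exponents: otherwise the iterate
     [j.+1] would lie strictly between them. *)
  have jk : j < k by apply: anti => //; lia.
  have [lt g] := iter_pred_step DP qn (ltac:(lia) : j.+1 < D q).
  have [e|ne] := eqVneq j.+1 k; first by rewrite ev eu -e.
  have [w wS ew] := mem j.+1 ltac:(lia).
  have := iter_pred_ltn DP qn (ltac:(lia) : j.+1 < k < D q).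
  by have := huv w wS; rewrite iterS in ew *; lia.
- move=> u /chain_setP[j jD eu] umax.
  have [i iS ei] := mem 0 D0.
  case: j jD eu => [_ -> //|j jD eu].
  have := iter_pred_ltn DP qn (ltac:(lia) : 0 < j.+1 < D q).
  by have := umax i iS; lia.
Qed.

Lemma chain_set_minimum q : q < n -> trailing n col q ->
  (forall e, e < n -> trailing n col e -> D q <= D e) ->
  minimum_consistent p c (chain_set q).
Proof.
move=> qn qt qmin; split; first exact/linked_consistent/chain_set_linked.
move=> S /(consistent_linked (leq_ltn_trans (leq0n q) qn)) hS.
rewrite card_chain_set //; have [i0 i0S] := linked_nonempty hS.
case: (@arg_maxnP _ i0 (mem S) (@nat_of_ord n) i0S) => e eS emax.
apply: leq_trans (qmin e (ltn_ord e) (linked_trailing hS eS emax)) _.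
apply: leq_trans (linked_card hS eS) _.
by apply/subset_leq_card/subsetP => i; rewrite inE => /andP[].
Qed.

End Consistent.

(** * Structured programs *)

Inductive test := WEq (a b : nat) | WLt (a b : nat) | RLt (a b : nat).

Definition jump (t : test) (l : nat) : instr :=
  match t with
  | WEq a b => WIfEq a b l | WLt a b => WIfLt a b l | RLt a b => RIfLt a b l
  end.

Definition holds (R : realType) (t : test) (s : config R) : bool :=
  match t with
  | WEq a b => wreg s a == wreg s b
  | WLt a b => wreg s a < wreg s b
  | RLt a b => (rreg s a < rreg s b)%R
  end.

Inductive code :=
| Do (i : instr)
| Seq (a b : code)
| Ite (t : test) (a b : code).

Declare Scope code_scope.
Delimit Scope code_scope with code.
Bind Scope code_scope with code.
Coercion Do : instr >-> code.
Notation "a ;; b" := (Seq a b)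
  (at level 61, right associativity, format "a ;;  '/' b") : code_scope.
Notation "'If' t 'Then' a 'Else' b" := (Ite t a b)
  (at level 60, t at level 55, a at level 60, b at level 60,
   format "'[v' 'If'  t '/' 'Then'  a '/' 'Else'  b ']'") : code_scope.

(** Jumps may only come from [compile]; every remaining instruction acts independently of its
    address and continues with the next one. *)
Fixpoint straight (c : code) : bool :=
  match c with
  | Do (Halt | Goto _) => false
  | Do (WIfEq _ _ _ | WIfLt _ _ _ | RIfEq _ _ _ | RIfLt _ _ _) => false
  | Do _ => true
  | Seq a b | Ite _ a b => straight a && straight b
  end.

Fixpoint csize (c : code) : nat :=
  match c with
  | Do _ => 1
  | Seq a b => csize a + csize b
  | Ite _ a b => (csize b + csize a).+2
  end.

(* [compile l c] is the code of [c] to be placed at the address [l]. *)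
Fixpoint compile (l : nat) (c : code) : program :=
  match c with
  | Do i => [:: i]
  | Seq a b => compile l a ++ compile (l + csize a) b
  | Ite t a b =>
      jump t (l + csize b).+2 :: compile l.+1 b ++
      Goto (l + csize b + csize a).+2 :: compile (l + csize b).+2 a
  end.

(** Tests cannot be negated, so the conditional jump skips over the exit jump into the body. *)
Definition loop (l : nat) (t : test) (c : code) : program :=
  [:: jump t l.+2, Goto (l + csize c).+3 & compile l.+2 c ++ [:: Goto l]].

(** * Execution of compiled code and step counts *)

Section Semantics.

Variable R : realType.
Implicit Types (s : config R) (P : program).

Definition at_pc (l : nat) s : config R :=
  Config l (wreg s) (rreg s) (wmem s) (rmem s).

Fixpoint exec (c : code) s : config R :=
  match c with
  | Do i => step [:: i] (at_pc 0 s)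
  | Seq a b => exec b (exec a s)
  | Ite t a b => if holds t s then exec a s else exec b s
  end.

Lemma size_compile l c : size (compile l c) = csize c.
Proof.
elim: c l => [i|a IHa b IHb|t a IHa b IHb] l //=.
  by rewrite size_cat IHa IHb.
by rewrite size_cat /= IHa IHb addnS.
Qed.

Lemma runD P j k s : run P (j + k) s = run P k (run P j s).
Proof. by rewrite /run addnC iterD. Qed.

Lemma run1 P s : run P 1 s = step P s.
Proof. by []. Qed.

Lemma fetch_at Q1 (i : instr) Q2 s : fetch (Q1 ++ i :: Q2) (at_pc (size Q1) s) = i.
Proof. by rewrite /fetch nth_cat ltnn subnn. Qed.

Lemma step_straight Q1 (i : instr) Q2 s : straight i ->
  step (Q1 ++ i :: Q2) (at_pc (size Q1) s) =
  at_pc (size Q1).+1 (step [:: i] (at_pc 0 s)).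
Proof.
move=> hi; have := fetch_at Q1 i Q2 s; rewrite /step /= => ->.
by case: i hi.
Qed.

Lemma step_goto Q1 l Q2 s :
  step (Q1 ++ Goto l :: Q2) (at_pc (size Q1) s) = at_pc l s.
Proof. by have := fetch_at Q1 (Goto l) Q2 s; rewrite /step /= => ->. Qed.

Lemma step_jump Q1 t l Q2 s :
  step (Q1 ++ jump t l :: Q2) (at_pc (size Q1) s) =
  at_pc (if holds t s then l else (size Q1).+1) s.
Proof.
by have := fetch_at Q1 (jump t l) Q2 s; rewrite /step /= => ->; case: t.
Qed.

(** Without loops every instruction is executed at most once, so the size of the code bounds the
    number of steps. *)
Lemma run_compile Q1 c Q2 s : straight c ->
  exists2 k, k <= csize c &
  run (Q1 ++ compile (size Q1) c ++ Q2) k (at_pc (size Q1) s) =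
  at_pc (size Q1 + csize c) (exec c s).
Proof.
elim: c Q1 Q2 s => [i|a IHa b IHb|t a IHa b IHb] Q1 Q2 s /=.
- by exists 1; rewrite // run1 step_straight // addn1.
- case/andP => sa sb.
  have [j ja ej] := IHa Q1 (compile (size Q1 + csize a) b ++ Q2) s sa.
  have [k kb ek] := IHb (Q1 ++ compile (size Q1) a) Q2 (exec a s) sb.
  exists (j + k); first lia.
  rewrite -catA runD ej addnA; move: ek.
  by rewrite size_cat size_compile -catA.
- case/andP => sa sb; case: (boolP (holds t s)) => ht.
  + pose Q := Q1 ++ jump t (size Q1 + csize b).+2 :: compile (size Q1).+1 b ++
      [:: Goto (size Q1 + csize b + csize a).+2].
    have eQ : size Q = (size Q1 + csize b).+2.
      by rewrite /Q !(size_cat, size_compile, =^~ addnS) /= size_cat size_compile /=; lia.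
    have [k ka ek] := IHa Q Q2 s sa; exists k.+1; first lia.
    rewrite -(add1n k) runD run1 step_jump ht; move: ek; rewrite eQ /Q.
    by rewrite -!(catA, cat_cons) /= => ->; congr at_pc; lia.
  + pose Q := rcons Q1 (jump t (size Q1 + csize b).+2).
    pose Q' := Goto (size Q1 + csize b + csize a).+2 ::
      compile (size Q1 + csize b).+2 a ++ Q2.
    (* The second branch is placed first, hence one extra step to jump over the other branch. *)
    have [k kb ek] := IHb Q Q' s sb; exists (k.+1 + 1); first lia.
    rewrite runD -(add1n k) runD !run1 step_jump (negPf ht).
    move: ek; rewrite /Q size_rcons cat_rcons -!(catA, cat_cons) => ->.
    rewrite ?run1.
    have := step_goto (rcons Q1 (jump t (size Q1 + csize b).+2) ++ compile (size Q1).+1 b)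
      (size Q1 + csize b + csize a).+2 (compile (size Q1 + csize b).+2 a ++ Q2) (exec b s).
    rewrite size_cat size_rcons size_compile cat_rcons -!(catA, cat_cons) => ->.
    by congr at_pc; lia.
Qed.

(** Besides the body, an iteration costs the test and the jump back; leaving costs the failed test
    and the exit jump. *)
Lemma run_loop (I : config R -> Prop) (mu : config R -> nat) Q1 t c Q2 s :
  straight c ->
  (forall s, I s -> holds t s -> I (exec c s) /\ mu (exec c s) < mu s) ->
  I s -> exists k s',
  [/\ k <= (csize c + 2) * mu s + 2,
      run (Q1 ++ loop (size Q1) t c ++ Q2) k (at_pc (size Q1) s) =
      at_pc (size Q1 + csize c + 3) s', I s' & ~~ holds t s'].
Proof.
move=> sc hI; move: {2}(mu s) (leqnn (mu s)) => N.
elim: N s => [|N IH] s hN hs.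
all: case: (boolP (holds t s)) => ht; last first.
1,3: exists 2, s; split=> //; rewrite ?leq_addl // -[2]add1n runD !run1 /loop !cat_cons;
  rewrite step_jump (negPf ht);
  have := step_goto (rcons Q1 (jump t (size Q1).+2)) (size Q1 + csize c).+3
    ((compile (size Q1).+2 c ++ [:: Goto (size Q1)]) ++ Q2) s;
  by rewrite size_rcons cat_rcons => ->; congr at_pc; lia.
  by have [_] := hI s hs ht; lia.
have [hs' lt] := hI s hs ht.
have [k [s' [hk ek Is' hs'']]] := IH _ (ltac:(lia) : mu (exec c s) <= N) hs'.
pose Q := rcons (rcons Q1 (jump t (size Q1).+2)) (Goto (size Q1 + csize c).+3).
have [j jc ej] := run_compile Q (Goto (size Q1) :: Q2) s sc.
exists (1 + j + 1 + k), s'; split=> //.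
  have : (csize c + 2) * (mu (exec c s)).+1 <= (csize c + 2) * mu s.
    by rewrite leq_mul2l lt orbT.
  by rewrite mulnS; lia.
rewrite !runD !run1 /loop !cat_cons step_jump ht.
move: ej; rewrite /Q !size_rcons !cat_rcons -!catA /= => ->.
have := step_goto (rcons (rcons Q1 (jump t (size Q1).+2)) (Goto (size Q1 + csize c).+3)
  ++ compile (size Q1).+2 c) (size Q1) Q2 (exec c s).
rewrite size_cat !size_rcons size_compile -!catA !cat_rcons /= => ->.
by rewrite -ek /loop !cat_cons -catA.
Qed.

End Semantics.

(** * The program *)

Local Notation rOut := 0 (only parsing).
Local Notation rN := 1 (only parsing).
Local Notation rV := 2 (only parsing).
Local Notation rG := 3 (only parsing).
Local Notation rF := 4 (only parsing).
Local Notation rLo := 5 (only parsing).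
Local Notation rA := 6 (only parsing).
Local Notation rB := 7 (only parsing).
Local Notation rQ := 8 (only parsing).
Local Notation rD := 9 (only parsing).
Local Notation rM := 10 (only parsing).
Local Notation rM1 := 11 (only parsing).
Local Notation rM2 := 12 (only parsing).
Local Notation rDv := 13 (only parsing).
Local Notation rPv := 14 (only parsing).
Local Notation rT := 15 (only parsing).
Local Notation rU := 16 (only parsing).
Local Notation rOne := 17 (only parsing).
Local Notation rZero := 18 (only parsing).
Local Notation rNN := 19 (only parsing).

Local Notation fDx := 0 (only parsing).
Local Notation fDy := 1 (only parsing).
Local Notation fXv := 2 (only parsing).
Local Notation fY := 3 (only parsing).
Local Notation fX := 4 (only parsing).
Local Notation fLow := 5 (only parsing).
Local Notation fHigh := 6 (only parsing).

Local Open Scope code_scope.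

Definition skip : code := WMove rT rT.

Definition get_x (d i : nat) : code :=
  WOp WAdd rT i i;; RLoad d rT;; ROp RMul d d fDx;;
  WOp WAdd rT rT rOne;; RLoad fY rT;; ROp RMul fY fY fDy;;
  ROp RAdd d d fY.

(** The value 2 in [rD] is the sentinel for the first block. [rQ] starts as the marker [n], so that
    nothing is output when there are no points. *)
Definition initialize : code :=
  WMove rN rOut;; WConst rOne 1;; WOp WAdd rNN rN rN;;
  WOp WSub rT rN rOne;; WOp WAdd rT rT rT;; RLoad fDx rT;;
  WOp WAdd rT rT rOne;; RLoad fDy rT;;
  RLoad fX rZero;; ROp RSub fDx fDx fX;;
  RLoad fX rOne;; ROp RSub fDy fDy fX;;
  WMove rQ rN;; WConst rD 2;; WConst rM1 1;; WConst rM2 2.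

Definition load_colors : code := WLoad rT rV;; WLoad rU rG.

Definition new_block : code :=
  WMove rF rG;; WMove rG rV;; WMove rLo rV;; WMove rA rV;; WMove rB rV;;
  WMove rM rD;; WOp WAdd rM1 rM rOne;; WOp WAdd rM2 rM1 rOne;;
  WOp WAdd rD rM2 rOne;;
  WOp WSub rDv rV rOne;; get_x fLow rDv;; ROp RAdd fLow fLow fLow;;
  get_x fHigh rV;; ROp RAdd fHigh fHigh fHigh.

Definition test_window : code :=
  get_x fXv rV;; WConst rU 0;;
  If WLt rF rLo Then
    (WOp WSub rDv rLo rOne;; get_x fX rDv;; ROp RAdd fX fX fXv;;
     If RLt fX fLow Then skip Else WConst rU 1)
  Else skip.

Definition move_window : code :=
  WOp WSub rLo rLo rOne;; WOp WAdd rT rN rLo;; WLoad rU rT;;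
  If WEq rU rM Then WMove rA rLo Else skip;;
  If WEq rU rM1 Then WMove rB rLo Else skip.

Definition try_candidate (cand value : nat) : code :=
  If WLt cand rG Then
    (get_x fX cand;; ROp RAdd fX fX fXv;;
     If RLt fHigh fX Then skip Else (WMove rDv value;; WMove rPv cand))
  Else skip.

(** The candidates are tried in order of increasing preference, each overwriting the previous
    choice: the block, then [rB], then [rA]. *)
Definition assign : code :=
  If WEq rG rZero Then (WMove rDv rOne;; WMove rPv rN)
  Else
    (WOp WAdd rDv rD rOne;; WMove rPv rQ;;
     try_candidate rB rM2;; try_candidate rA rM1).

Definition advance : code :=
  WOp WAdd rT rN rV;; WStore rT rDv;; WOp WAdd rT rNN rV;; WStore rT rPv;;
  If WLt rDv rD Then (WMove rD rDv;; WMove rQ rV) Else skip;;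
  WOp WAdd rV rV rOne.

(** Moving the window, treating a point and opening a block are iterations of one loop, so that a
    single potential bounds the total work. *)
Definition scan_body : code :=
  load_colors;;
  If WEq rT rU Then
    (test_window;;
     If WEq rU rOne Then move_window Else (assign;; advance))
  Else new_block.

Definition trace_body : code :=
  WStore rOut rQ;; WOp WAdd rOut rOut rOne;; WOp WAdd rT rNN rQ;; WLoad rQ rT.


(** * The scanning loop: machine invariant and potential *)

Section ScanMachine.

Variables (R : realType) (n : nat) (c : nat -> nat) (mr : nat -> R) (d : R * R).

Definition proj_x (i : nat) : R := (mr (i + i)%N * d.1 + mr (i + i + 1)%N * d.2)%R.

Hypothesis x_mono : forall i j, i < j -> j < n -> (proj_x i < proj_x j)%R.

(** The word memory has three segments of length [n]: the colors, [D] and [P]. *)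
Definition mem_D (s : config R) (i : nat) : nat := wmem s (n + i).
Definition mem_P (s : config R) (i : nat) : nat := wmem s (n + n + i).

Record scanning (s : config R) : Prop := Scanning {
  scanning_n : wreg s rN = n;
  scanning_one : wreg s rOne = 1;
  scanning_zero : wreg s rZero = 0;
  scanning_nn : wreg s rNN = n + n;
  scanning_m1 : wreg s rM1 = (wreg s rM).+1;
  scanning_m2 : wreg s rM2 = (wreg s rM).+2;
  scanning_dx : rreg s fDx = d.1;
  scanning_dy : rreg s fDy = d.2;
  scanning_low : 0 < wreg s rG ->
    rreg s fLow = (proj_x (wreg s rG).-1 + proj_x (wreg s rG).-1)%R;
  scanning_high : 0 < wreg s rG ->
    rreg s fHigh = (proj_x (wreg s rG) + proj_x (wreg s rG))%R;
  scanning_mr : rmem s = mr;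
  scanning_col : forall i, i < n -> wmem s i = c i;
  scanning_scan :
    scan n proj_x c (wreg s rV) (wreg s rG) (wreg s rF) (wreg s rLo) (wreg s rA)
      (wreg s rB) (wreg s rQ) (wreg s rD) (wreg s rM) (mem_D s) (mem_P s) }.

(* Each iteration moves [v] to the right, moves [lo] to the left, or starts a
   block; the sizes of all blocks add up to [n]. *)
Definition potential (s : config R) : nat :=
  3 * (n - wreg s rV) + (wreg s rLo - wreg s rF) + (wreg s rV - wreg s rG) +
  (c (wreg s rV) != c (wreg s rG)).

(* [s'] differs from [s] at most in the scratch registers. *)
Definition same_state (s s' : config R) : Prop :=
  [/\ [seq wreg s' k | k <- iota 1 12 ++ [:: rOne; rZero; rNN]] =
      [seq wreg s k | k <- iota 1 12 ++ [:: rOne; rZero; rNN]],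
      [seq rreg s' k | k <- [:: fDx; fDy; fLow; fHigh]] =
      [seq rreg s k | k <- [:: fDx; fDy; fLow; fHigh]],
      wmem s' = wmem s & rmem s' = rmem s].

Lemma same_state_trans s1 s2 s3 :
  same_state s1 s2 -> same_state s2 s3 -> same_state s1 s3.
Proof.
move=> [a1 b1 c1 d1] [a2 b2 c2 d2].
by split; [rewrite a2|rewrite b2|rewrite c2|rewrite d2].
Qed.

Lemma scanning_same s s' : same_state s s' -> scanning s -> scanning s'.
Proof.
case: s s' => [l w r mw mr0] [l' w' r' mw' mr0'] [/= + + -> ->].
case=> e1 e2 e3 e4 e5 e6 e7 e8 e9 e10 e11 e12 e13 e14 e15 [f1 f2 f3 f4] [] /=.
rewrite -{}e1 -{}e2 -{}e3 -{}e4 -{}e5 -{}e6 -{}e7 -{}e8 -{}e9 -{}e10 -{}e11 -{}e12.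
by rewrite -{}e13 -{}e14 -{}e15 -{}f1 -{}f2 -{}f3 -{}f4; split.
Qed.

Lemma potential_same s s' : same_state s s' -> potential s' = potential s.
Proof.
by case=> [[_ e2 e3 e4 e5 *]]; rewrite /potential e2 e3 e4 e5.
Qed.

Lemma exec_load_colors s : scanning s -> wreg s rV < n ->
  let s' := exec load_colors s in
  [/\ same_state s s', wreg s' rT = c (wreg s' rV) & wreg s' rU = c (wreg s' rG)].
Proof.
case: s => l w r mw mr' [] /= _ _ _ _ _ _ _ _ _ _ _ hc hs vn.
by split; rewrite /= ?hc //; have := scan_gv hs; lia.
Qed.

(** The old term [v - g] becomes the new window allowance [lo - f], and the summand for differing
    colors is spent. *)
Lemma exec_new_block s : scanning s -> wreg s rV < n ->
  c (wreg s rV) <> c (wreg s rG) ->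
  scanning (exec new_block s) /\ potential (exec new_block s) < potential s.
Proof.
case: s => l w r mw mr' [] /= h1 h2 h3 h4 h5 h6 h7 h8 h9 h10 h11 hc hs vn hcol.
split; last first.
  rewrite /potential /= eqxx; move/eqP: hcol => ->; have := scan_gv hs; lia.
have hn := scan_new_block hs vn hcol.
split=> //=.
- by rewrite h2 addn1.
- by rewrite h2 !addn1.
- by move=> _; rewrite h2 h7 h8 h11 subn1.
- by move=> _; rewrite h2 h7 h8 h11.
- by rewrite h2 !addn1.
Qed.

Lemma exec_test_window s : scanning s -> wreg s rV < n ->
  let s' := exec test_window s in
  [/\ same_state s s', rreg s' fXv = proj_x (wreg s' rV)
    & (wreg s' rU == wreg s' rOne) = (wreg s' rF < wreg s' rLo) &&
        (proj_x (wreg s' rG).-1 + proj_x (wreg s' rG).-1 <=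
         proj_x (wreg s' rLo).-1 + proj_x (wreg s' rV))%R].
Proof.
case: s => l w r mw mr' [] /= h1 h2 h3 h4 h5 h6 h7 h8 h9 h10 h11 hc hs vn.
have eV : (mr' (w rV + w rV)%N * r 0 + mr' (w rV + w rV + w rOne)%N * r 1)%R =
    proj_x (w rV) by rewrite h2 h7 h8 h11.
have eL : (mr' (w rLo - w rOne + (w rLo - w rOne))%N * r 0 +
   mr' (w rLo - w rOne + (w rLo - w rOne) + w rOne)%N * r 1)%R = proj_x (w rLo).-1.
  by rewrite h2 h7 h8 h11 subn1.
case: ltnP => fl /=; last by split; rewrite //= h2 ltnNge fl.
have g0 : 0 < w rG by have := scan_lo hs; lia.
by rewrite eL eV h9 //; case: ifP => hw /=; split; rewrite //= h2 fl leNgt hw.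
Qed.

Lemma exec_move_window s : scanning s -> wreg s rV < n -> wreg s rF < wreg s rLo ->
  (proj_x (wreg s rG).-1 + proj_x (wreg s rG).-1 <=
   proj_x (wreg s rLo).-1 + proj_x (wreg s rV))%R ->
  scanning (exec move_window s) /\ potential (exec move_window s) < potential s.
Proof.
case: s => l w r mw mr' [] /= h1 h2 h3 h4 h5 h6 h7 h8 h9 h10 h11 hc hs vn fl hw.
have hm := scan_move hs vn fl hw.
have eD : mw (w rN + (w rLo - w rOne)) = mem_D (Config l w r mw mr') (w rLo).-1.
  by rewrite h1 h2 subn1.
move: hm; rewrite eD; case: eqP => e1 /=; rewrite ?eD h5 /mem_D /=; case: eqP => e2 hm.
all: split; [split=> //=; rewrite h2 subn1 //|rewrite /potential /= h2; lia].
Qed.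

Lemma exec_try_candidate s cand value :
  cand \in [:: rA; rB] -> value \in [:: rM1; rM2] ->
  scanning s -> 0 < wreg s rG -> rreg s fXv = proj_x (wreg s rV) ->
  let s' := exec (try_candidate cand value) s in
  [/\ same_state s s', rreg s' fXv = rreg s fXv &
      (wreg s' rDv, wreg s' rPv) =
      if (wreg s cand < wreg s rG) &&
         (proj_x (wreg s cand) + proj_x (wreg s rV) <=
          proj_x (wreg s rG) + proj_x (wreg s rG))%R
      then (wreg s value, wreg s cand) else (wreg s rDv, wreg s rPv)].
Proof.
case: s => l w r mw mr' + + [] /= h1 h2 h3 h4 h5 h6 h7 h8 h9 h10 h11 hc hs g0 xv.
have e : (mr' (w cand + w cand)%N * r 0 + mr' (w cand + w cand + w rOne)%N * r 1)%R =
    proj_x (w cand) by rewrite h2 h7 h8 h11.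
rewrite !inE => /orP[]/eqP ec /orP[]/eqP ev; subst cand value.
all: case: ltnP => lt /=; last by split.
all: by rewrite e xv h10 // leNgt; case: ifP => lr /=; split.
Qed.

Lemma exec_assign s : scanning s -> rreg s fXv = proj_x (wreg s rV) ->
  let s' := exec assign s in
  same_state s s' /\
  assigned n proj_x (wreg s rV) (wreg s rG) (wreg s rA) (wreg s rB) (wreg s rQ)
    (wreg s rD) (wreg s rM) (wreg s' rDv) (wreg s' rPv).
Proof.
move=> hs xv.
pose s1 := exec (WOp WAdd rDv rD rOne;; WMove rPv rQ) s.
pose s2 := exec (try_candidate rB rM2) s1; pose s3 := exec (try_candidate rA rM1) s2.
have -> : exec assign s = if holds (WEq rG rZero) s
  then exec (WMove rDv rOne;; WMove rPv rN) s else s3 by [].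
case: ifP => [/eqP|/negbT] hg.
  rewrite (scanning_zero hs) in hg; move: (scanning_n hs) (scanning_one hs) hg.
  by case: (s) => l w r mw mr' /= -> -> hg; split; [|apply: AssignFirst].
have g0 : 0 < wreg s rG by move: hg; rewrite /= (scanning_zero hs) lt0n.
have ss1 : same_state s s1 by rewrite /s1; case: (s).
have e1 : (wreg s1 rDv, wreg s1 rPv) = ((wreg s rD).+1, wreg s rQ).
  move: (scanning_one hs); rewrite /s1.
  by case: (s) => l w r mw mr' /= ->; rewrite addn1.
have xv1 : rreg s1 fXv = rreg s fXv by rewrite /s1; case: (s).
have eqs s' : same_state s s' -> [/\ scanning s', wreg s' rV = wreg s rV,
    wreg s' rG = wreg s rG, wreg s' rA = wreg s rA & wreg s' rB = wreg s rB] /\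
    (wreg s' rM1 = (wreg s rM).+1 /\ wreg s' rM2 = (wreg s rM).+2).
  move=> h; split; last first.
    have hs' := scanning_same h hs; rewrite (scanning_m1 hs') (scanning_m2 hs').
    by case: h => [[_ _ _ _ _ _ _ _ _ -> *]].
  have hs' := scanning_same h hs.
  by case: h => [[_ -> -> _ _ -> -> *]].
have [[hs1 v1 gg1 a1 b1] [m11 m12]] := eqs s1 ss1.
have [] := @exec_try_candidate s1 rB rM2 erefl erefl hs1; rewrite ?v1 ?gg1 ?xv1 //.
rewrite -/s2 => ss12 xv2 e2; have ss2 := same_state_trans ss1 ss12.
have [[hs2 v2 gg2 a2 b2] [m21 m22]] := eqs s2 ss2.
have [] := @exec_try_candidate s2 rA rM1 erefl erefl hs2; rewrite ?v2 ?gg2 ?xv2 ?xv1 //.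
rewrite -/s3 => ss23 _ e3; have ss3 := same_state_trans ss2 ss23.
split=> //; move: e3 e2.
rewrite a2 b1 e1 m21 m12; case: ltnP => ag /=.
  case: lerP => wa; first by move=> [-> ->] _; apply: AssignLow.
  move=> [-> ->]; case: ltnP => bg /=.
    by case: lerP => wb [-> ->]; [apply: AssignHigh|apply: AssignBlock].
  by move=> [-> ->]; apply: AssignBlock => // bg'; lia.
move=> [-> ->]; case: ltnP => bg /=.
  by case: lerP => wb [-> ->]; [apply: AssignHigh|apply: AssignBlock] => // ag'; lia.
by move=> [-> ->]; apply: AssignBlock => // ?; lia.
Qed.

Lemma exec_advance s : scanning s -> wreg s rV < n ->
  c (wreg s rV) = c (wreg s rG) ->
  (wreg s rF < wreg s rLo ->
    (proj_x (wreg s rLo).-1 + proj_x (wreg s rV) <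
     proj_x (wreg s rG).-1 + proj_x (wreg s rG).-1)%R) ->
  assigned n proj_x (wreg s rV) (wreg s rG) (wreg s rA) (wreg s rB) (wreg s rQ)
    (wreg s rD) (wreg s rM) (wreg s rDv) (wreg s rPv) ->
  scanning (exec advance s) /\ potential (exec advance s) < potential s.
Proof.
case: s => l w r mw mr' [] /= h1 h2 h3 h4 h5 h6 h7 h8 h9 h10 h11 hc hs vn.
move=> hcol hlo hass.
pose mw' := [eta [eta mw with n + w rV |-> w rDv] with n + n + w rV |-> w rPv].
pose D' i := mw' (n + i); pose P' i := mw' (n + n + i).
have hs' : scan n proj_x c (w rV) (w rG) (w rF) (w rLo) (w rA) (w rB) (w rQ) (w rD)
    (w rM) D' P'.
  apply: scan_ext hs => i iv; rewrite /D' /P' /mem_D /mem_P /mw' /= !eqn_add2l.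
    by rewrite (ltn_eqF iv) ifN //; apply/eqP; lia.
  by rewrite (ltn_eqF iv) ifN //; apply/eqP; lia.
have Dv : D' (w rV) = w rDv by rewrite /D' /mw' /= ifN ?eqxx //; apply/eqP; lia.
have Pv : P' (w rV) = w rPv by rewrite /P' /mw' /= eqxx.
have hn := scan_assign x_mono hs' vn hcol hlo hass Dv Pv.
have hc' i : i < n -> mw' i = c i.
  by move=> iN; rewrite /mw' /= !ifN ?hc //; apply/eqP; lia.
(* The factor 3 pays for the growth of [v - g], for a possible change of color at the next point,
   and for a strict decrease. *)
have pot b : 3 * (n - (w rV).+1) + (w rLo - w rF) + ((w rV).+1 - w rG) + (b : bool) <
    3 * (n - w rV) + (w rLo - w rF) + (w rV - w rG) + (c (w rV) != c (w rG)).
  by have := scan_gv hs; case: b; lia.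
case: ltnP hn => lt hn /=; rewrite h1 h2 h4 addn1.
all: by split; [split|exact: pot].
Qed.

Lemma exec_scan_body s : scanning s -> wreg s rV < n ->
  scanning (exec scan_body s) /\ potential (exec scan_body s) < potential s.
Proof.
move=> hs vn; pose s1 := exec load_colors s; pose s2 := exec test_window s1.
pose s3 := exec assign s2.
have -> : exec scan_body s = if holds (WEq rT rU) s1 then
    if holds (WEq rU rOne) s2 then exec move_window s2 else exec advance s3
  else exec new_block s1 by [].
have [] := exec_load_colors hs vn; rewrite -/s1; clearbody s1 => ss1 T1 U1.
have hs1 := scanning_same ss1 hs; rewrite -(potential_same ss1).
have v1 : wreg s1 rV < n by case: ss1 => [[_ -> *]].
rewrite /holds T1 U1; case: eqP => hcol; last exact: exec_new_block.
have [] := exec_test_window hs1 v1; rewrite -/s2; clearbody s2 => ss2 xv2 U2.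
have hs2 := scanning_same ss2 hs1; rewrite -(potential_same ss2).
have v2 : wreg s2 rV < n by case: ss2 => [[_ -> *]].
have hcol2 : c (wreg s2 rV) = c (wreg s2 rG) by case: ss2 => [[_ -> -> *]].
rewrite U2; case: ifP => [/andP[fl hw]|hw]; first exact: exec_move_window.
have [] := exec_assign hs2 xv2; rewrite -/s3; clearbody s3 => ss3.
have hs3 := scanning_same ss3 hs2; rewrite -(potential_same ss3).
move: v2 hcol2 hw; case: ss3 => [[_ <- <- eF eLo <- <- <- <- <- _ _ _ _ _] _ _ _].
move=> v2 hcol2 hw hass.
apply: exec_advance => // fl.
by move: hw; rewrite -eF -eLo fl /= leNgt => /negbFE.
Qed.

Lemma scanning_init s :
  d = (mr (n.-1 + n.-1)%N - mr 0, mr (n.-1 + n.-1 + 1)%N - mr 1)%R ->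
  wreg s = (fun k => if k == 0 then n else 0) -> rmem s = mr ->
  (forall i, i < n -> wmem s i = c i) ->
  scanning (exec initialize s) /\ potential (exec initialize s) = 3 * n.
Proof.
case: s => l w r mw mr' ed /= -> -> hc; split; last first.
  by rewrite /potential /= eqxx; lia.
by split; rewrite //= ?subn1 ed.
Qed.

End ScanMachine.

(** * The output loop *)

Section TraceMachine.

Variables (R : realType) (n q len : nat) (P : nat -> nat).
Hypothesis P_len : iter len P q = n.
Hypothesis P_lt : forall j, j < len -> iter j P q < n.
Hypothesis len_n : len <= n.

Record tracing (s : config R) : Prop := Tracing {
  tracing_n : wreg s rN = n;
  tracing_one : wreg s rOne = 1;
  tracing_nn : wreg s rNN = n + n;
  tracing_len : wreg s rOut <= len;
  tracing_q : wreg s rQ = iter (wreg s rOut) P q;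
  tracing_mem : forall j, j < wreg s rOut -> wmem s j = iter j P q;
  tracing_P : forall i, i < n -> mem_P n s i = P i }.

Lemma exec_trace_body s : tracing s -> wreg s rQ < wreg s rN ->
  tracing (exec trace_body s) /\
  len - wreg (exec trace_body s) rOut < len - wreg s rOut.
Proof.
case: s => l w r mw mr [] /= h1 h2 h3 hl hq hm hP qn; rewrite h1 in qn.
have lt : w rOut < len.
  (* After [len] outputs [rQ] would hold the marker [n] and the test would fail. *)
  rewrite ltn_neqAle hl andbT; apply/eqP => e.
  by move: qn; rewrite hq e P_len ltnn.
split; last by rewrite h2; lia.
split; rewrite //= ?h2 ?addn1 //.
- rewrite h3 ifN; last by apply/eqP; lia.
  by rewrite iterS -hq; apply: hP.
- move=> j; rewrite ltnS leq_eqVlt => /orP[/eqP ->|jl]; first by rewrite eqxx.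
  by rewrite ltn_eqF // hm.
- by move=> i iN; rewrite /mem_P /= ifN; [apply: hP|apply/eqP; lia].
Qed.

Lemma tracing_end s : tracing s -> ~~ (wreg s rQ < wreg s rN) ->
  wreg s rOut = len /\ mkseq (wmem s) len = traject P q len.
Proof.
move=> hs; rewrite (tracing_n hs) => qn.
have e : wreg s rOut = len.
  apply/eqP; rewrite eqn_leq (tracing_len hs) leqNgt; apply: contra qn => lt.
  by rewrite (tracing_q hs) P_lt.
split=> //; apply: (@eq_from_nth _ 0); first by rewrite size_mkseq size_traject.
move=> i; rewrite size_mkseq => il; rewrite nth_mkseq // (tracing_mem hs) ?e //.
by rewrite (set_nth_default q) ?size_traject // nth_traject.
Qed.

End TraceMachine.

(** * The whole program and its running time *)

Definition mcs_program : program :=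
  let l1 := csize initialize in
  let l2 := l1 + csize scan_body + 3 in
  compile 0 initialize ++ loop l1 (WLt rV rN) scan_body ++
  compile l2 (WConst rOut 0) ++ loop l2.+1 (WLt rQ rN) trace_body.

(** The scan starts with potential [3 * n], the isolated 1 resets [rOut], and the output loop has at
    most [n] iterations. *)
Definition mcs_time (n : nat) : nat :=
  csize initialize + ((csize scan_body + 2) * (3 * n) + 2) + 1 +
  ((csize trace_body + 2) * n + 2).

Lemma size_loop l t c : size (loop l t c) = csize c + 3.
Proof. by rewrite /loop /= size_cat size_compile /= addn1 addn3. Qed.

(** * Coordinates along the line *)

Section Projection.

Variables (R : realType) (n : nat) (p : n.-tuple (R * R)) (col : n.-tuple nat).

Definition coords : nat -> R := rmem (input p col).

Definition direction : R * R :=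
  (coords (n.-1 + n.-1)%N - coords 0%N, coords (n.-1 + n.-1 + 1)%N - coords 1%N)%R.

Lemma coords_fst i : coords (i + i) = (nth (0, 0)%R p i).1.
Proof. by rewrite /coords /= addnn odd_double doubleK. Qed.

Lemma coords_snd i : coords (i + i + 1) = (nth (0, 0)%R p i).2.
Proof. by rewrite /coords /= addnn addn1 /= odd_double uphalf_double. Qed.

(** Differences of [proj_x] are those of the parameter [t] times a constant [K > 0], and distances
    are those of [t] times the length of the direction vector, so order and comparisons of distances
    agree. *)
Lemma sorted_on_line_proj : sorted_on_line p ->
  (forall i j, i < j -> j < n ->
     (proj_x coords direction i < proj_x coords direction j)%R) /\
  (forall i j k : 'I_n,
     (edist (tnth p i) (tnth p j) <= edist (tnth p i) (tnth p k))%R =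
     (`|proj_x coords direction i - proj_x coords direction j| <=
      `|proj_x coords direction i - proj_x coords direction k|)%R).
Proof.
case=> a [[d1 d2] [t [d0 tlt ep]]]; rewrite /= in ep.
pose dd := (d1 ^+ 2 + d2 ^+ 2)%R.
have dd0 : (0 < dd)%R.
  rewrite lt_neqAle addr_ge0 ?sqr_ge0 // andbT eq_sym paddr_eq0 ?sqr_ge0 //.
  by rewrite !sqrf_eq0; apply: contra d0 => /andP[/eqP -> /eqP ->].
have edistE i j : edist (tnth p i) (tnth p j) = (Num.sqrt dd * `|t i - t j|)%R.
  rewrite -sqrtr_sqr -sqrtrM ?ltW // /edist !ep /=; congr Num.sqrt.
  rewrite /dd; ring.
(* With at most one point the first and last points do not determine a direction, but nothing has to
   be compared. *)
have [lt1n|len1] := ltnP 1 n; last first.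
  split=> [i j ij jn|i j k]; first lia.
  have -> : j = i by apply: val_inj; case: i j {k} => i + [j +] /=; lia.
  have -> : k = i by apply: val_inj; case: i k {j} => i + [k +] /=; lia.
  by rewrite !lexx.
pose i0 := Ordinal (ltnW lt1n); pose i1 := Ordinal (ltac:(lia) : n.-1 < n).
pose K := ((t i1 - t i0) * dd)%R.
have K0 : (0 < K)%R by rewrite mulr_gt0 // subr_gt0 tlt //=; lia.
have nthE (i : 'I_n) : nth (0, 0)%R p i = (a.1 + t i * d1, a.2 + t i * d2)%R.
  by rewrite -tnth_nth ep.
have projB (i j : 'I_n) :
    (proj_x coords direction i - proj_x coords direction j = K * (t i - t j))%R.
  have c0 : coords 0 = (a.1 + t i0 * d1)%R by rewrite -[0]addn0 coords_fst (nthE i0).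
  have c1 : coords 1 = (a.2 + t i0 * d2)%R.
    by rewrite -[1]/(0 + 0 + 1) coords_snd (nthE i0).
  rewrite /proj_x /direction !coords_fst !coords_snd c0 c1 (nthE i) (nthE j).
  by rewrite (nthE i1) /K /dd /=; ring.
clearbody K; split=> [i j ij jn|i j k].
  have lt := tlt (Ordinal (ltn_trans ij jn)) (Ordinal jn) ij.
  rewrite -subr_gt0 -[i]/(nat_of_ord (Ordinal (ltn_trans ij jn))).
  by rewrite -[j]/(nat_of_ord (Ordinal jn)) projB mulr_gt0 // subr_gt0.
rewrite !edistE !projB !normrM (gtr0_norm K0) !ler_pM2l //.
by rewrite sqrtr_gt0.
Qed.

End Projection.

Lemma bigO_mcs_time : bigO_linear mcs_time.
Proof.
(* The bound is affine in [n] with nonnegative coefficients, so its value at 1 is a valid slope for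
   positive [n]. *)
exists (mcs_time 1), 1 => n n0; rewrite /mcs_time.
set a := csize _; set b := csize _; set e := csize _; nia.
Qed.

Lemma mcs_program_correct (R : realType) : solves_mcs_in_time R mcs_program mcs_time.
Proof.
move=> n p col hp; have [x_mono edist_le] := sorted_on_line_proj col hp.
pose mr := coords p col; pose d := direction p col.
pose c k := nth 0 col k; pose s0 := input p col.
pose l1 := csize initialize; pose l2 := l1 + csize scan_body + 3.
have [hs1 pot1] := @scanning_init R n c mr d s0 erefl erefl erefl (fun _ _ => erefl).
have [k1 hk1 e1] := run_compile [::]
  (loop l1 (WLt rV rN) scan_body ++ compile l2 (WConst rOut 0) ++
   loop l2.+1 (WLt rQ rN) trace_body) s0 (erefl : straight initialize).
set s1 := exec initialize s0 in hs1 pot1 e1; clearbody s1.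
have body (s : config R) : scanning n c mr d s -> holds (WLt rV rN) s ->
    scanning n c mr d (exec scan_body s) /\
    potential n c (exec scan_body s) < potential n c s.
  by move=> hs; rewrite /holds (scanning_n hs); apply: exec_scan_body.
have [k2 [s2 [hk2 e2 hs2]]] := run_loop (compile 0 initialize)
  (compile l2 (WConst rOut 0) ++ loop l2.+1 (WLt rQ rN) trace_body)
  (erefl : straight scan_body) body hs1.
rewrite /holds (scanning_n hs2) -leqNgt => nv.
set q := wreg s2 rQ; set D := mem_D n s2; set P := mem_P n s2.
have vn : wreg s2 rV = n by apply/eqP; rewrite eqn_leq nv (scan_vn (scanning_scan hs2)).
have hscan := scanning_scan hs2; rewrite vn -/q -/D -/P in hscan.
have [len [S [P_len P_lt len_n hS hmin]]] : exists len (S : {set 'I_n}),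
    [/\ iter len P q = n, forall j, j < len -> iter j P q < n, len <= n,
        perm_eq (traject P q len) [seq nat_of_ord i | i <- enum S]
      & minimum_consistent p col S].
  (* Without points [q] is still the initial marker, and the empty set is output. *)
  have [n0|n0] := posnP n.
    exists 0, set0; split=> //; first exact: scan_q0 hscan n0.
    - by rewrite enum_set0.
    - split; last by rewrite cards0.
      by move=> i; have := ltn_ord i; lia.
  have [qn qt qmin] := scan_end hscan n0; have DP := scan_short hscan.
  exists (D q), (chain_set n D P q); split.
  - by case: (iter_pred_last DP qn).
  - by move=> j jD; case: (iter_pred DP qn jD).
  - exact: leq_trans (shortest_le DP qn) qn.
  - exact: (chain_set_enum DP qn).
  - exact: (chain_set_minimum x_mono edist_le DP qn qt qmin).
pose s3 := exec (WConst rOut 0) s2.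
have hs3 : tracing n q len P s3.
  move: (scanning_n hs2) (scanning_one hs2) (scanning_nn hs2).
  by rewrite /s3 /q /P; case: (s2).
have sl : size (compile 0 initialize ++ loop l1 (WLt rV rN) scan_body) = l2.
  by rewrite size_cat size_compile size_loop addnA.
have [k3 hk3] := run_compile (compile 0 initialize ++ loop l1 (WLt rV rN) scan_body)
  (loop l2.+1 (WLt rQ rN) trace_body) s2 (erefl : straight (WConst rOut 0)).
rewrite sl -catA -/s3 addn1 => e3; clearbody s3.
have sl' : size (compile 0 initialize ++ loop l1 (WLt rV rN) scan_body ++
    compile l2 (WConst rOut 0)) = l2.+1 by rewrite catA size_cat sl addn1.
have tbody (s : config R) : tracing n q len P s -> holds (WLt rQ rN) s ->
    tracing n q len P (exec trace_body s) /\
    len - wreg (exec trace_body s) rOut < len - wreg s rOut.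
  exact: (exec_trace_body P_len len_n).
have [k4 [s4 [hk4 e4 hs4 q4]]] 
  := run_loop (mu := fun s => len - wreg s rOut)
  (compile 0 initialize ++ loop l1 (WLt rV rN) scan_body ++ compile l2 (WConst rOut 0))
  [::] (erefl : straight trace_body) tbody hs3.
have [len4 out4] := tracing_end P_lt hs4 q4.
rewrite sl' cats0 -!catA in e4; rewrite size_compile in e2.
have eT : run mcs_program (k1 + k2 + k3 + k4) s0 = at_pc (l2.+1 + csize trace_body + 3) s4.
  by rewrite !runD [run _ k1 _]e1 [run _ k2 _]e2 [run _ k3 _]e3 [run _ k4 _]e4.
exists (k1 + k2 + k3 + k4), S; rewrite -/s0 eT; split=> //.
- rewrite /mcs_time; apply: leq_add; last first.
    apply: leq_trans hk4 _; rewrite leq_add2r leq_mul2l; apply/orP; right; lia.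
  by apply: leq_add => //; apply: leq_add => //; rewrite -pot1.
- by rewrite /outputs len4 out4.
Qed.

Theorem theorem4 (R : realType) :
  exists (P : program) (T : nat -> nat),
    bigO_linear T /\ solves_mcs_in_time R P T.
Proof.
exists mcs_program, mcs_time; split; [exact: bigO_mcs_time | exact: mcs_program_correct].
Qed.
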